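(* Let $G$ be a compact real algebraic group with neutral element $e$, let $X \subset \mathbb{R}^n$ be a $G$-real algebraic set, and let $x \in X$ such that $G_x = \{e\}$. Then the polynomial map $\alpha_x : G \to G \cdot x$, $g \mapsto g \cdot x$, is a polynomial isomorphism.
   Context: A real algebraic set of $\mathbb{R}^m$ is the zero set of a family of polynomials with real coefficients. A real algebraic group is a real algebraic set $G \subset \mathbb{R}^m$ with a group structure whose multiplication $G\times G \to G$ and inverse map $G \to G$ are restrictions of polynomial maps; it is compact if it is compact for the Euclidean topology. A $G$-real algebraic set is a real algebraic set $X \subset \mathbb{R}^n$ equipped with a group action $G \times X \to X$, $(g,x)\mapsto g\cdot x$, which is the restriction of a polynomial map. $G_x = \{g \in G \mid g \cdot x = x\}$ is the stabilizer of $x$ and $G\cdot x$ its orbit, which is a real algebraic set because $G$ is compact. A polynomial isomorphism between real algebraic sets is a bijection which is the restriction of a polynomial map and whose inverse is also the restriction of a polynomial map. *)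

(* Defs.v *)
(* R^m is rendered as ['rV[R]_m], whose product topology is the Euclidean one. *)
From HB Require Import structures.
From mathcomp Require Export all_boot all_order all_algebra.
From mathcomp Require Export all_classical all_reals all_analysis.
(* The notations of multinomials' mpoly clash with those of MathComp-Analysis:
   polynomials in n variables are written [mpoly n R], and [meval v p] is the
   value of p at v : 'I_n -> R. *)
From mathcomp Require Export -(notations) mpoly.

Set Implicit Arguments.
Unset Strict Implicit.
Unset Printing Implicit Defensive.

Import Order.TTheory GRing.Theory Num.Theory.
Import numFieldNormedType.Exports.

Local Open Scope classical_set_scope.
Local Open Scope ring_scope.

Definition real_algebraic (R : realType) (m : nat) (A : set 'rV[R]_m) : Prop :=
  exists F : set (mpoly m R),
    A = [set x | forall p, F p -> meval (x ord0) p = 0].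

Definition poly_map (R : realType) (m n : nat) (p : 'I_n -> mpoly m R)
    (x : 'rV[R]_m) : 'rV[R]_n :=
  \row_(i < n) meval (x ord0) (p i).

(* Maps between sets are represented by total functions on the ambient spaces;
   only their values on the source set matter. *)
Definition polynomial_on (R : realType) (m n : nat) (A : set 'rV[R]_m)
    (f : 'rV[R]_m -> 'rV[R]_n) : Prop :=
  exists p : 'I_n -> mpoly m R, forall x, A x -> f x = poly_map p x.

(* Same for maps defined on A x B, a subset of R^(m + n). *)
Definition polynomial_on2 (R : realType) (m n k : nat)
    (A : set 'rV[R]_m) (B : set 'rV[R]_n)
    (f : 'rV[R]_m -> 'rV[R]_n -> 'rV[R]_k) : Prop :=
  exists p : 'I_k -> mpoly (m + n) R,
    forall x y, A x -> B y -> f x y = poly_map p (row_mx x y).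

Definition polynomial_isomorphism (R : realType) (m n : nat)
    (A : set 'rV[R]_m) (B : set 'rV[R]_n) (f : 'rV[R]_m -> 'rV[R]_n) : Prop :=
  [/\ real_algebraic A, real_algebraic B, set_bij A B f, polynomial_on A f &
      exists2 g : 'rV[R]_n -> 'rV[R]_m,
        forall x, A x -> g (f x) = x & polynomial_on B g].

Record real_algebraic_group (R : realType) (m : nat) := RealAlgebraicGroup {
  grp_set : set 'rV[R]_m;
  grp_one : 'rV[R]_m;
  grp_mul : 'rV[R]_m -> 'rV[R]_m -> 'rV[R]_m;
  grp_inv : 'rV[R]_m -> 'rV[R]_m;
  grp_algebraic : real_algebraic grp_set;
  grp_oneP : grp_set grp_one;
  grp_mulP : forall g h, grp_set g -> grp_set h -> grp_set (grp_mul g h);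
  grp_invP : forall g, grp_set g -> grp_set (grp_inv g);
  grp_mulA : forall g h k, grp_set g -> grp_set h -> grp_set k ->
    grp_mul g (grp_mul h k) = grp_mul (grp_mul g h) k;
  grp_mul1g : forall g, grp_set g -> grp_mul grp_one g = g;
  grp_mulg1 : forall g, grp_set g -> grp_mul g grp_one = g;
  grp_mulVg : forall g, grp_set g -> grp_mul (grp_inv g) g = grp_one;
  grp_mulgV : forall g, grp_set g -> grp_mul g (grp_inv g) = grp_one;
  grp_mul_poly : polynomial_on2 grp_set grp_set grp_mul;
  grp_inv_poly : polynomial_on grp_set grp_inv
}.

Record G_real_algebraic_set (R : realType) (m : nat)
    (G : real_algebraic_group R m) (n : nat) := GRealAlgebraicSet {
  gset : set 'rV[R]_n;
  gset_act : 'rV[R]_m -> 'rV[R]_n -> 'rV[R]_n;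
  gset_algebraic : real_algebraic gset;
  gset_actP : forall g x, grp_set G g -> gset x -> gset (gset_act g x);
  gset_act1 : forall x, gset x -> gset_act (grp_one G) x = x;
  gset_actM : forall g h x, grp_set G g -> grp_set G h -> gset x ->
    gset_act (grp_mul G g h) x = gset_act g (gset_act h x);
  gset_act_poly : polynomial_on2 (grp_set G) gset gset_act
}.

Definition G_stabilizer (R : realType) (m n : nat) (G : real_algebraic_group R m)
    (X : G_real_algebraic_set G n) (x : 'rV[R]_n) : set 'rV[R]_m :=
  [set g | grp_set G g /\ gset_act X g x = x].

Definition G_orbit (R : realType) (m n : nat) (G : real_algebraic_group R m)
    (X : G_real_algebraic_set G n) (x : 'rV[R]_n) : set 'rV[R]_n :=
  [set gset_act X g x | g in grp_set G].

(* Main.v *)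
(** The orbit map is inverted by averaging. Let [t] be a polynomial function on
    [G]. Its translates span a finite-dimensional space, so that there are
    polynomial maps [f] and [rho], row-vector- and matrix-valued, with
    [f (g h) = f g * rho h], and [t] is a combination of the entries of [f].
    Let [phi h] be [(1 - c |h x - x|^2)^k], a polynomial function of [h x]
    which, as the stabilizer of [x] is trivial, is peaked at the neutral element.
    Right invariance of the Haar mean [I] gives
      [I_h (phi (h g) f (h^-1)) = f g * I_h (phi h rho (h^-1))].
    The left-hand side is a polynomial in [g x], and for large [k] the matrix on
    the right is close to a nonzero multiple of the identity, hence invertible.
    So [f], and with it [t], is a polynomial in [g x]; taking for [t] the
    coordinates of [g] yields the inverse. An invariant mean is only needed on a
    finite-dimensional space of functions, where it is a fixed point of a compact
    group acting on a compact convex set. *)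
Require Import Defs.
From mathcomp Require Import ring lra finmap.
Import Order.TTheory GRing.Theory Num.Theory.
Import numFieldNormedType.Exports.
Local Open Scope classical_set_scope.
Local Open Scope ring_scope.

Set Implicit Arguments.
Unset Strict Implicit.
Unset Printing Implicit Defensive.

(** * Linear algebra *)

(** Take a free family of values of [u] of maximal size. Sizes are bounded by [J], and a value
    outside the span could be adjoined. *)
Lemma exists_row_basis (F : fieldType) (T : Type) (J : nat) (u : T -> 'rV[F]_J) :
  exists (N : nat) (t : 'I_N -> T),
    let B := \matrix_l u (t l) in row_free B /\ forall s, (u s <= B)%MS.
Proof.
pose free N := `[< exists t : 'I_N -> T, row_free (\matrix_l u (t l)) >].
have free0 : free 0%N.
  apply/asboolP; exists (fun i : 'I_0 => match notF (ltn_ord i) with end).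
  by rewrite /row_free flatmx0 mxrank0.
have free_le N : free N -> (N <= J)%N.
  by move=> /asboolP[t /eqP <-]; exact: rank_leq_col.
have [N /asboolP[t freeB] Nmax] := ex_maxnP (ex_intro free 0%N free0) free_le.
exists N, t; split=> // s; apply: contrapT => /negP nBs.
suff /asboolP /Nmax : exists t : 'I_N.+1 -> T, row_free (\matrix_l u (t l)) by rewrite ltnn.
exists (fun l : 'I_(1 + N) => match fintype.split l with inl _ => s | inr l => t l end).
have -> : \matrix_l u (match fintype.split l with inl _ => s | inr l => t l end) =
    col_mx (u s) (\matrix_l u (t l)) :> 'M[F]_(1 + N, J).
  apply/row_matrixP => l; rewrite rowK; case: (split_ordP l) => i ->.
    by rewrite rowKu ord1; apply/rowP => j; rewrite mxE.
  by rewrite rowKd rowK.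
set B := \matrix_l u (t l) in freeB nBs *.
apply: (@inj_row_free _ (1 + N) J) => v; rewrite -[v]hsubmxK mul_row_col.
have -> : lsubmx v = (lsubmx v ord0 ord0)%:M by rewrite [LHS]mx11_scalar.
rewrite mul_scalar_mx; set a := lsubmx v _ _; set w := rsubmx v.
have [->|a0] := eqVneq a 0.
  rewrite scale0r add0r => /(congr1 (mulmx^~ (pinvmx B))).
  by rewrite -mulmxA mulmxVp // mulmx1 mul0mx => ->; rewrite raddf0 row_mx0.
move=> /(canRL (addrK _)); rewrite sub0r => auE; case/negP: nBs.
rewrite -[u s](scalerK a0) auE; apply: scalemx_sub.
by rewrite -mulNmx submxMl.
Qed.

(** Diagonal dominance: a nonzero vector [v] with [v *m M = 0] is contradicted at a coordinate of
    largest modulus. The factor [N.+1] instead of [N] makes the comparison strict. *)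
Lemma unitmx_near_scalar (F : realFieldType) (N : nat) (M : 'M[F]_N) (s : F) :
  0 < s -> (forall i j, `|M i j - s * (i == j)%:R| * N.+1%:R <= s) -> M \in unitmx.
Proof.
move=> s0 Ms; rewrite -row_free_unit -kermx_eq0; apply/eqP/row_matrixP => k.
have : row k (kermx M) *m M = 0 by rewrite -row_mul mulmx_ker row0.
rewrite row0; move: (row k _) => v vM; apply/eqP; apply: contraT => v0.
have /rV0Pn[j0 vj0] := v0.
pose l := [arg max_(l > j0) `|v ord0 l|]%O.
have vl j : `|v ord0 j| <= `|v ord0 l|.
  by rewrite /l; case: arg_maxP => //= i _; apply.
have vl0 : 0 < `|v ord0 l| by apply: lt_le_trans (vl j0); rewrite normr_gt0.
have vlE : s * v ord0 l = - \sum_i v ord0 i * (M i l - s * (i == l)%:R).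
  have /matrixP/(_ ord0 l) := vM; rewrite !mxE => vM0.
  rewrite (eq_bigr _ (fun i _ => mulrBr _ _ _)) sumrB vM0 sub0r.
  rewrite (bigD1 l) //= eqxx big1 ?addr0 => [|i /negPf ->].
    by rewrite mulr1 opprK mulrC.
  by rewrite !mulr0.
have : N.+1%:R * `|s * v ord0 l| <= N%:R * (s * `|v ord0 l|).
  rewrite vlE normrN.
  apply: (@le_trans _ _
    (N.+1%:R * \sum_i (`|v ord0 i| * `|M i l - s * (i == l)%:R|))).
    rewrite ler_pM2l ?ltr0n //; apply: le_trans (ler_norm_sum _ _ _) _.
    by apply: ler_sum => i _; rewrite normrM.
  apply: (@le_trans _ _ (\sum_(i < N) s * `|v ord0 l|)); last first.
    by rewrite sumr_const card_ord mulr_natl.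
  rewrite mulr_sumr; apply: ler_sum => i _.
  have := Ms i l; have := vl i; have := normr_ge0 (v ord0 i); nra.
rewrite normrM gtr0_norm // -natr1.
have : 0 < s * `|v ord0 l| by rewrite mulr_gt0.
have : 0 <= N%:R :> F by rewrite ler0n.
nra.
Qed.

(** * Polynomial functions *)

Lemma continuous_bigop (T : topologicalType) (U : topologicalType) (op : U -> U -> U)
    (x0 : U) (I : Type) (r : seq I) (F : I -> T -> U) :
  continuous (fun z : U * U => op z.1 z.2) -> (forall i, continuous (F i)) ->
  continuous (fun x => \big[op/x0]_(i <- r) F i x).
Proof. by move=> cop cF x; apply: cvg_big => // i _; exact: cF. Qed.

Definition polyfun (R : realType) (m : nat) (A : set 'rV[R]_m)
    (f : 'rV[R]_m -> R) : Prop :=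
  exists p : mpoly m R, forall x, A x -> f x = meval (x ord0) p.

Section Polyfun.
Variables (R : realType) (m : nat).
Implicit Types (A : set 'rV[R]_m) (f g : 'rV[R]_m -> R).

Lemma polyfun_ext A f g : (forall x, A x -> f x = g x) ->
  polyfun A f -> polyfun A g.
Proof. by move=> fg [p fE]; exists p => x Ax; rewrite -fg // fE. Qed.

Lemma polyfun_meval A (p : mpoly m R) :
  polyfun A (fun x => meval (x ord0) p).
Proof. by exists p. Qed.

Lemma polyfun_coord A i : polyfun A (fun x => x ord0 i).
Proof. by exists (mpolyX R (mnm1 i)) => x _; rewrite mevalXU. Qed.

Lemma polyfun_cst A c : polyfun A (fun=> c).
Proof. by exists (mpolyC m c) => x _; rewrite mevalC. Qed.

Lemma polyfunD A f g : polyfun A f -> polyfun A g ->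
  polyfun A (fun x => f x + g x).
Proof.
by move=> [p fE] [q gE]; exists (p + q) => x Ax; rewrite mevalD fE ?gE.
Qed.

Lemma polyfunM A f g : polyfun A f -> polyfun A g ->
  polyfun A (fun x => f x * g x).
Proof.
by move=> [p fE] [q gE]; exists (p * q) => x Ax; rewrite mevalM fE ?gE.
Qed.

Lemma polyfunB A f g : polyfun A f -> polyfun A g ->
  polyfun A (fun x => f x - g x).
Proof.
by move=> [p fE] [q gE]; exists (p - q) => x Ax; rewrite mevalB fE ?gE.
Qed.

Lemma polyfunX A f k : polyfun A f -> polyfun A (fun x => f x ^+ k).
Proof.
move=> pf; elim: k => [|k IHk]; first exact: polyfun_cst.
by apply: polyfun_ext (polyfunM pf IHk) => x _; rewrite exprS.
Qed.

Lemma polyfun_sum A (I : Type) (r : seq I) (F : I -> 'rV[R]_m -> R) :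
  (forall i, polyfun A (F i)) -> polyfun A (fun x => \sum_(i <- r) F i x).
Proof.
move=> pF; elim: r => [|i r IHr].
  by apply: polyfun_ext (polyfun_cst A 0) => x _; rewrite big_nil.
by apply: polyfun_ext (polyfunD (pF i) IHr) => x _; rewrite big_cons.
Qed.

Lemma polyfun_comp A k (u : 'I_k -> 'rV[R]_m -> R) (p : mpoly k R) :
  (forall i, polyfun A (u i)) -> polyfun A (fun x => meval (u^~ x) p).
Proof.
move=> pu; have [q uE] := choice pu.
exists (comp_mpoly [tuple q i | i < k] p) => x Ax.
rewrite comp_mpoly_meval; apply: meval_eq => i.
by rewrite tnth_mktuple uE.
Qed.

Lemma meval_continuous (p : mpoly m R) :
  continuous (fun x : 'rV[R]_m => meval (x ord0) p).
Proof.
suff sumP (I : Type) (r : seq I) (c : I -> R) (mon : I -> 'I_m -> nat) :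
    continuous (fun x : 'rV[R]_m => \sum_(k <- r) c k * \prod_i x ord0 i ^+ mon k i).
  rewrite (_ : (fun _ => _) = fun x : 'rV[R]_m =>
    \sum_(k <- msupp p) mcoeff k p * \prod_i x ord0 i ^+ k i); first exact: sumP.
  by apply/funext => x; rewrite mevalE.
apply: continuous_bigop => [|k x]; first exact: add_continuous.
apply: (@continuousM _ _ (fun=> c k)); first exact: cst_continuous.
move: x; change (continuous (fun x : 'rV[R]_m => \prod_i x ord0 i ^+ mon k i)).
apply: (@continuous_bigop _ _ _ _ _ _ (fun i (x : 'rV[R]_m) => x ord0 i ^+ mon k i))
  => [|i x]; first exact: mul_continuous.
apply: (@continuous_comp _ _ _ (fun x : 'rV[R]_m => x ord0 i) (fun t => t ^+ mon k i)).
  exact: coord_continuous.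
exact: exprn_continuous.
Qed.

Lemma polyfun_continuous A f : polyfun A f -> {within A, continuous f}.
Proof.
move=> [p fE].
apply: (@subspace_eq_continuous _ _ _ (fun x : 'rV[R]_m => meval (x ord0) p)).
  by move=> x /set_mem Ax; exact/esym/fE.
exact/continuous_subspaceT/meval_continuous.
Qed.

Lemma polyfun_bounded A f : compact A -> polyfun A f ->
  exists2 B, 0 < B & forall x, A x -> `|f x| <= B.
Proof.
move=> cA pf.
have [[a Aa]|/nonemptyPn A0] := pselect (A !=set0); last first.
  by exists 1 => // x; rewrite A0.
have [||c _ cmax] := @EVT_max_rV R m (fun x => (f x) ^+ 2) A _ cA; first by exists a.
  exact/polyfun_continuous/polyfunX.
(* The maximum is that of the square; [|f x| <= f x ^+ 2 + 1] turns it into a positive bound for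
   [|f x|]. *)
exists (f c ^+ 2 + 1) => [|x Ax]; first by rewrite ltr_wpDl ?sqr_ge0.
have := cmax x (mem_set Ax).
have : `|f x| ^+ 2 = f x ^+ 2 by rewrite real_normK ?num_real.
nra.
Qed.

End Polyfun.

(** Each monomial up to a common degree splits into its parts in the two groups of variables. Thus
    the [q j] are the same for all [s]; the coefficients of [p s] go into [mu s j]. *)
Lemma meval_split (R : realType) (S : finType) (m n : nat)
    (p : S -> mpoly (m + n) R) :
  exists (J : nat) (q : 'I_J -> mpoly m R) (mu : S -> 'I_J -> mpoly n R),
  forall s (x : 'rV[R]_m) (y : 'rV[R]_n),
    meval ((row_mx x y) ord0) (p s) =
      \sum_j meval (x ord0) (q j) * meval (y ord0) (mu s j).
Proof.
pose k := \max_s mmeasure mdeg (p s).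
pose J := #|{: bmultinom (m + n) k}|.
pose mon (j : 'I_J) : multinom (m + n) := bmnm (enum_val j).
exists J, (fun j => mpolyX R (Multinom [tuple mon j (lshift n i) | i < m])).
exists (fun s j => mcoeff (mon j) (p s) *:
  mpolyX R (Multinom [tuple mon j (rshift m i) | i < n])).
move=> s x y.
have ps : (mmeasure mdeg (p s) <= k)%N by rewrite /k (leq_bigmax s).
rewrite {1}(mpolywE ps) raddf_sum /=.
rewrite (reindex (@enum_val _ {: bmultinom (m + n) k})) /=; last first.
  by apply: onW_bij; exact: enum_val_bij.
apply: eq_bigr => j _; rewrite !mevalZ !mevalX big_split_ord /= mulrCA.
congr (_ * (_ * _)); apply: eq_bigr => i _; rewrite mnmE.
- by rewrite row_mxEl.
- by rewrite row_mxEr.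
Qed.

(** * Translation-stable spaces of polynomial functions *)

Lemma polyfun_row_mxl (R : realType) (m n : nat) (A : set 'rV[R]_m) (y : 'rV[R]_n)
    (p : mpoly (m + n) R) :
  polyfun A (fun x => meval ((row_mx x y) ord0) p).
Proof.
apply: (@polyfun_comp _ _ _ _ (fun i x => (row_mx x y) ord0 i)) => i.
case: (split_ordP i) => k ->.
  by apply: polyfun_ext (polyfun_coord A k) => x _; rewrite row_mxEl.
by apply: polyfun_ext (polyfun_cst A (y ord0 k)) => x _; rewrite row_mxEr.
Qed.

Lemma poly_mapE (R : realType) (m n : nat) (p : 'I_n -> mpoly m R) (x : 'rV[R]_m) i :
  poly_map p x ord0 i = meval (x ord0) (p i).
Proof. by rewrite mxE. Qed.

Section Group.
Variables (R : realType) (m : nat) (G : real_algebraic_group R m).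
Local Notation GG := (grp_set G).
Local Notation "g '*g' h" := (grp_mul G g h) (at level 40, left associativity).

Lemma polyfun_mulr f g : polyfun GG f -> GG g -> polyfun GG (fun h => f (h *g g)).
Proof.
move=> [p fE] Gg; have [q mE] := grp_mul_poly G.
apply: (@polyfun_ext _ _ _ (fun h => meval ((h *g g) ord0) p)).
  by move=> h Gh; rewrite fE //; exact: grp_mulP.
apply: (@polyfun_comp _ _ _ _ (fun i h => (h *g g) ord0 i)) => i.
apply: polyfun_ext (polyfun_row_mxl GG g (q i)) => h Gh.
by rewrite mE // poly_mapE.
Qed.

Lemma polyfun_inv f : polyfun GG f -> polyfun GG (fun h => f (grp_inv G h)).
Proof.
move=> [p fE]; have [q iE] := grp_inv_poly G.
apply: (@polyfun_ext _ _ _ (fun h => meval (grp_inv G h ord0) p)).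
  by move=> h Gh; rewrite fE //; exact: grp_invP.
apply: (@polyfun_comp _ _ _ _ (fun i h => grp_inv G h ord0 i)) => i.
by apply: polyfun_ext (polyfun_meval GG (q i)) => h Gh; rewrite iE // poly_mapE.
Qed.

(** Splitting the variables writes [psi s (g *g h)] as a pairing of a vector in [g] with the vector
    [u s h]. A basis [B] of the span of all [u s h] selects the translates that are the entries of
    [e], and coordinates in [B] give [rho] and [C]. Freeness of [B] gives [rho] its value at the
    neutral element. *)
Lemma exists_stable_span (S : finType) (psi : S -> 'rV[R]_m -> R) :
  (forall s, polyfun GG (psi s)) ->
  exists (N : nat) (e : 'rV[R]_m -> 'rV[R]_N) (rho : 'rV[R]_m -> 'M[R]_N)
      (C : S -> 'cV[R]_N),
    [/\ forall l, polyfun GG (fun g => e g ord0 l),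
        forall i l, polyfun GG (fun g => rho g i l),
        forall g h, GG g -> GG h -> e (g *g h) = e g *m rho h,
        rho (grp_one G) = 1%:M &
        forall s g, GG g -> psi s g = (e g *m C s) ord0 ord0].
Proof.
move=> psiP; have [p psiE] := choice psiP; have [pm mE] := grp_mul_poly G.
pose P s := comp_mpoly [tuple pm i | i < m] (p s).
have PE s g h : GG g -> GG h -> psi s (g *g h) = meval ((row_mx g h) ord0) (P s).
  move=> Gg Gh; rewrite psiE; last exact: grp_mulP.
  rewrite comp_mpoly_meval; apply: meval_eq => i.
  by rewrite tnth_mktuple mE // poly_mapE.
have [J [q [mu splitE]]] := meval_split P.
pose T := {x : S * 'rV[R]_m | GG x.2}.
pose u (s : S) (g : 'rV[R]_m) : 'rV[R]_J := \row_j meval (g ord0) (mu s j).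
have [N [t]] := @exists_row_basis R T J (fun x => u (sval x).1 (sval x).2).
pose st l := (sval (t l)).1; pose gt l := (sval (t l)).2.
have Ggt l : GG (gt l) by exact: (svalP (t l)).
move=> /=; set B := \matrix_l _ => -[freeB spanB].
(* [pinvmx B] is constant, so the coordinates in [B] remain polynomial in [g]. *)
pose c s g := u s g *m pinvmx B.
have cE s g : GG g -> u s g = c s g *m B.
  move=> Gg; rewrite /c mulmxKpV //.
  exact: (spanB (exist (fun x : S * 'rV[R]_m => GG x.2) (s, g) Gg)).
pose qv (g : 'rV[R]_m) : 'rV[R]_J := \row_j meval (g ord0) (q j).
have psi_mul s g h : GG g -> GG h ->
    psi s (g *g h) = (qv g *m (u s h)^T) ord0 ord0.
  by move=> Gg Gh; rewrite PE // splitE mxE; apply: eq_bigr => j _; rewrite !mxE.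
pose e g : 'rV[R]_N := \row_l psi (st l) (g *g gt l).
have eE g : GG g -> e g = qv g *m B^T.
  move=> Gg; apply/rowP => l; rewrite mxE psi_mul // !mxE.
  by apply: eq_bigr => j _; rewrite !mxE.
have psiM s g h : GG g -> GG h -> psi s (g *g h) = (e g *m (c s h)^T) ord0 ord0.
  by move=> Gg Gh; rewrite psi_mul // cE // trmx_mul mulmxA eE.
have polyc s l : polyfun GG (fun g => c s g ord0 l).
  apply: (@polyfun_ext _ _ _
    (fun g => \sum_j meval (g ord0) (mu s j) * pinvmx B j l)).
    by move=> g _; rewrite /c mxE; apply: eq_bigr => j _; congr (_ * _); rewrite mxE.
  apply: polyfun_sum => j; apply: polyfunM (polyfun_cst _ _).
  exact: polyfun_meval.
exists N, e, (fun g => \matrix_(i, l) c (st l) (g *g gt l) ord0 i),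
  (fun s => (c s (grp_one G))^T).
split.
- move=> l; apply: polyfun_ext (polyfun_mulr (psiP (st l)) (Ggt l)) => g _.
  by rewrite [RHS]mxE.
- move=> i l; apply: polyfun_ext (polyfun_mulr (polyc (st l) i) (Ggt l)) => g _.
  by rewrite [RHS]mxE.
- move=> g h Gg Gh; apply/rowP => l.
  rewrite mxE -grp_mulA // psiM //; last exact: grp_mulP.
  rewrite [LHS]mxE [RHS]mxE; apply: eq_bigr => i _.
  by congr (_ * _); rewrite [LHS]mxE [RHS]mxE.
- apply/matrixP => i l; rewrite mxE grp_mul1g // /c.
  have -> : u (st l) (gt l) = row l B by rewrite rowK.
  by rewrite -row_mul mulmxVp // !mxE eq_sym.
- by move=> s g Gg; rewrite -psiM ?grp_mulg1 //; exact: grp_oneP.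
Qed.

End Group.

(** * Invariant means *)

Lemma polyfun_mulmx (R : realType) (m N k : nat) (A : set 'rV[R]_m)
    (e : 'rV[R]_m -> 'rV[R]_N) (b : 'M[R]_(N, k)) j :
  (forall l, polyfun A (fun x => e x ord0 l)) ->
  polyfun A (fun x => (e x *m b) ord0 j).
Proof.
move=> eP; apply: (@polyfun_ext _ _ _ (fun x => \sum_l e x ord0 l * b l j)).
  by move=> x _; rewrite mxE.
by apply: polyfun_sum => l; apply: polyfunM (polyfun_cst _ _).
Qed.

Lemma closed_polyfun_le (R : realType) (m : nat) (f : 'rV[R]_m -> R) (c : R) :
  polyfun setT f -> closed [set x | f x <= c].
Proof.
move=> [p fE].
rewrite (_ : mkset _ = (fun x : 'rV[R]_m => meval (x ord0) p) @^-1` [set t | t <= c]).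
  by apply: preimage_closed; [move=> x _; exact: meval_continuous|exact: closed_le].
by apply/seteqP; split=> x /=; rewrite fE.
Qed.

Definition sqnorm (R : realType) (N : nat) (v : 'rV[R]_N) : R :=
  \sum_j v ord0 j ^+ 2.

Lemma sqnorm_ge0 (R : realType) (N : nat) (v : 'rV[R]_N) : 0 <= sqnorm v.
Proof. by apply: sumr_ge0 => j _; exact: sqr_ge0. Qed.

Lemma sqnorm_eq0 (R : realType) (N : nat) (v : 'rV[R]_N) :
  sqnorm v = 0 -> v = 0.
Proof.
move=> /psumr_eq0P v0; apply/rowP => j; rewrite mxE.
by apply/eqP; rewrite -sqrf_eq0 v0 // => k _; exact: sqr_ge0.
Qed.

(** The parallelogram law, a quantitative form of strict convexity. *)
Lemma sqnorm_midpoint (R : realType) (N : nat) (u v : 'rV[R]_N) :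
  sqnorm (2^-1 *: (u + v)) =
    2^-1 * (sqnorm u + sqnorm v) - 4^-1 * sqnorm (u - v).
Proof.
rewrite /sqnorm -big_split !mulr_sumr -sumrB; apply: eq_bigr => j _.
by rewrite !mxE /=; field.
Qed.

Lemma polyfun_sqnorm (R : realType) (m N : nat) (A : set 'rV[R]_m)
    (e : 'rV[R]_m -> 'rV[R]_N) :
  (forall l, polyfun A (fun x => e x ord0 l)) -> polyfun A (fun x => sqnorm (e x)).
Proof. by move=> eP; apply: polyfun_sum => l; exact: polyfunX. Qed.

Section Mean.
Variables (R : realType) (m : nat) (G : real_algebraic_group R m).
Hypothesis cG : compact (grp_set G).
Local Notation GG := (grp_set G).
Local Notation "g '*g' h" := (grp_mul G g h) (at level 40, left associativity).

(* [K] is the closed convex hull of the [e g], presented as an intersection of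
   half-spaces. Right translations act on it; a point of [K] minimising the
   largest norm over its orbit is unique by strict convexity, hence fixed. *)
Lemma exists_fixed_mean (N : nat) (e : 'rV[R]_m -> 'rV[R]_N)
    (rho : 'rV[R]_m -> 'M[R]_N) :
  (forall l, polyfun GG (fun g => e g ord0 l)) ->
  (forall i l, polyfun GG (fun g => rho g i l)) ->
  (forall g h, GG g -> GG h -> e (g *g h) = e g *m rho h) ->
  exists v : 'rV[R]_N,
    (forall (b : 'cV_N) c, (forall g, GG g -> (e g *m b) ord0 ord0 <= c) ->
      (v *m b) ord0 ord0 <= c) /\
    (forall g, GG g -> v *m rho g = v).
Proof.
move=> eP rhoP e_rho.
pose P := [set bc : 'cV[R]_N * R |
  forall g, GG g -> (e g *m bc.1) ord0 ord0 <= bc.2].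
pose K := [set v : 'rV[R]_N | forall bc, P bc -> (v *m bc.1) ord0 ord0 <= bc.2].
have G1 := grp_oneP G.
have Ke g : GG g -> K (e g) by move=> Gg bc; exact.
have Krho v g : K v -> GG g -> K (v *m rho g).
  move=> Kv Gg [b c] /= Pbc; rewrite -mulmxA; apply: (Kv (_, _)) => h Gh /=.
  by rewrite mulmxA -e_rho //; apply: Pbc; exact: grp_mulP.
have Kmid u v : K u -> K v -> K (2^-1 *: (u + v)).
  move=> Ku Kv bc Pbc; rewrite -scalemxAl mulmxDl !mxE.
  by have := Ku _ Pbc; have := Kv _ Pbc; rewrite !mxE; lra.
(* Linear relations satisfied by all [e g] pass to [K]: use the half-spaces given by a column of [b]
   and by its opposite. *)
have Keq v k (b : 'M[R]_(N, k)) :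
    K v -> (forall g, GG g -> e g *m b = 0 :> 'rV_k) -> v *m b = 0.
  move=> Kv eb; apply/rowP => j; rewrite [RHS]mxE.
  have vb c : (forall g, GG g -> e g *m c = 0 :> 'rV_1) -> (v *m c) ord0 ord0 <= 0.
    by move=> ec; apply: (Kv (_, _)) => g Gg; rewrite ec // mxE.
  have colE (x : 'rV[R]_N) : (x *m b) ord0 j = (x *m col j b) ord0 ord0.
    by rewrite !mxE; apply: eq_bigr => i _; rewrite mxE.
  have ebj g : GG g -> e g *m col j b = 0.
    by move=> Gg; apply/rowP => i; rewrite ord1 -colE eb // !mxE.
  apply/eqP; rewrite eq_le colE vb //=.
  have := vb (- col j b); rewrite mulmxN mxE oppr_le0; apply=> g Gg.
  by rewrite mulmxN ebj ?oppr0.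
(* The entries of [e] may be linearly dependent, so [rho] is multiplicative only when applied to
   vectors of [K]. *)
have rhoM v g h : K v -> GG g -> GG h -> v *m rho g *m rho h = v *m rho (g *g h).
  move=> Kv Gg Gh; apply/eqP; rewrite -subr_eq0 -mulmxA -mulmxBr; apply/eqP.
  apply: Keq => // k Gk; rewrite mulmxBr mulmxA -!e_rho //; try exact: grp_mulP.
  by rewrite grp_mulA // subrr.
have rho1 v : K v -> v *m rho (grp_one G) = v.
  move=> Kv; apply/eqP; rewrite -[X in _ == X]mulmx1 -subr_eq0 -mulmxBr; apply/eqP.
  by apply: Keq => // k Gk; rewrite mulmxBr mulmx1 -e_rho // grp_mulg1 ?subrr.
(* [K] is closed as an intersection of half-spaces, and lies in a box because the entries of [e] are
   bounded on [G]. *)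
have cK : compact K.
  have /choice[B BP] l : exists b, forall g, GG g -> `|e g ord0 l| <= b.
    by have [b _ ?] := polyfun_bounded cG (eP l); exists b.
  apply: (@subclosed_compact _ _
    [set v : 'rV[R]_N | forall l, `[- B l, B l]%classic (v ord0 l)]).
  - rewrite (_ : K = \bigcap_(bc in P) [set v | (v *m bc.1) ord0 ord0 <= bc.2]).
      apply: closed_bigI => bc _; apply: closed_polyfun_le.
      by apply: polyfun_mulmx => l; exact: polyfun_coord.
    by apply/seteqP; split.
  - by apply: (rV_compact (A := fun l => `[- B l, B l]%classic)) => l; exact: segment_compact.
  - move=> v Kv l /=; rewrite in_itv /=.
    have deltaE (x : 'rV[R]_N) : (x *m delta_mx l ord0 : 'rV_1) ord0 ord0 = x ord0 l.
      rewrite mxE (bigD1 l) //= big1 ?addr0 => [|i /negPf il].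
        by rewrite mxE !eqxx mulr1.
      by rewrite mxE il mulr0.
    apply/andP; split.
      have := Kv (- delta_mx l ord0, B l); rewrite /= mulmxN mxE deltaE lerNl; apply.
      move=> g Gg /=; rewrite mulmxN mxE deltaE; have := BP l g Gg.
      by rewrite ler_norml lerNl => /andP[].
    rewrite -deltaE; apply: (Kv (_, _)) => g Gg /=; rewrite deltaE.
    exact: le_trans (ler_norm _) (BP l g Gg).
have sqP v : polyfun GG (fun g => sqnorm (v *m rho g)).
  apply: polyfun_sqnorm => l.
  apply: (@polyfun_ext _ _ _ (fun g => \sum_i v ord0 i * rho g i l)).
    by move=> g _; rewrite mxE.
  by apply: polyfun_sum => i; apply: polyfunM (polyfun_cst _ _) _.
(* [D] collects the bounds of the squared norm along the orbit of some point of [K]. A point of [K]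
   lying in [bnd a] for every [a] in [D] is the desired minimiser; the finite intersection property
   provides one. *)
pose bnd a := [set v | forall g, GG g -> sqnorm (v *m rho g) <= a].
pose D := [set a | exists2 v, K v & bnd a v].
have D0 : D !=set0.
  have [B _ Bp] := polyfun_bounded cG (sqP (e (grp_one G))).
  exists B, (e (grp_one G)); first exact: Ke.
  by move=> g Gg; exact: le_trans (ler_norm _) (Bp g Gg).
have [v vP] : \bigcap_(a in D) (K `&` bnd a) !=set0.
  move: cK; rewrite compact_In0; apply.
    exists bnd => // a _.
    rewrite (_ : bnd a = \bigcap_(g in GG) [set v | sqnorm (v *m rho g) <= a]).
      apply: closed_bigI => g Gg; apply/closed_polyfun_le/polyfun_sqnorm => l.
      by apply: polyfun_mulmx => i; exact: polyfun_coord.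
    by apply/seteqP; split.
  move=> F FD.
  (* The sets [bnd a] grow with [a], so the least threshold in [F] decides; if [F] is empty, any
     element of [D] serves. *)
  have [a [[v Kv bv] aF]] : exists a, D a /\ forall b, b \in enum_fset F -> a <= b.
    have : forall b, b \in (enum_fset F) -> D b by move=> b bF; apply/set_mem/FD.
    elim: (enum_fset F) => [_|b s IHs sD].
      by have [a Da] := D0; exists a; split.
    have [a [Da ale]] := IHs (fun c cs => sD c (mem_behead (s := b :: s) cs)).
    have [ab|ba] := leP a b.
      by exists a; split=> // c; rewrite inE => /orP[/eqP ->|/ale].
    exists b; split; first by apply: sD; rewrite mem_head.
    move=> c; rewrite inE => /orP[/eqP -> //|/ale]; exact/le_trans/ltW.
  by exists v => b bF; split=> // g Gg; exact: le_trans (bv g Gg) (aF b bF).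
have [a0 Da0] := D0; have [Kv _] := vP _ Da0.
exists v; split=> [b c bc|k Gk]; first exact: (Kv (b, c)).
(* Let the orbit of the midpoint [w] of [u] and [v] have its largest norm at [g0]. The square of
   that norm is in [D], hence bounds the orbit of [v], which contains the translates of [u] and [v]
   by [g0]. By the parallelogram law these translates coincide, and the inverse of [g0] brings this
   back to [u = v]. *)
set u := v *m rho k; have Ku : K u by exact: Krho.
have Kw := Kmid _ _ Ku Kv; set w := _ *: _ in Kw.
have [g0 /set_mem Gg0 g0max] :=
  @EVT_max_rV _ _ _ _ (ex_intro _ _ G1) cG (polyfun_continuous (sqP w)).
have vle g : GG g -> sqnorm (v *m rho g) <= sqnorm (w *m rho g0).
  move=> Gg; have /vP[_] : D (sqnorm (w *m rho g0)); last by apply.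
  by exists w => // h Gh; apply: g0max; exact: mem_set.
have ule : sqnorm (u *m rho g0) <= sqnorm (w *m rho g0).
  by rewrite rhoM //; apply: vle; exact: grp_mulP.
have : sqnorm (u *m rho g0 - v *m rho g0) = 0.
  have := vle _ Gg0; move: ule.
  rewrite /w -scalemxAl mulmxDl sqnorm_midpoint.
  have := sqnorm_ge0 (u *m rho g0 - v *m rho g0); lra.
move=> /sqnorm_eq0/eqP; rewrite subr_eq0 => /eqP uv.
have Gi := grp_invP Gg0.
by rewrite -[LHS]rho1 // -[RHS]rho1 // -(grp_mulgV Gg0) -!rhoM // uv.
Qed.

End Mean.

Section MeanTheory.
Variables (R : realType) (m : nat) (G : real_algebraic_group R m).
Local Notation GG := (grp_set G).
Local Notation "g '*g' h" := (grp_mul G g h) (at level 40, left associativity).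

(* [I] is meaningful only on the space [V] of functions, which is in practice
   finite-dimensional. *)
Record invariant_mean (V : set ('rV[R]_m -> R)) (I : ('rV[R]_m -> R) -> R) : Prop := {
  mean_dom_ext : forall F H, (forall g, GG g -> F g = H g) -> V F -> V H;
  mean_dom_cst : forall c, V (fun=> c);
  mean_dom_lin : forall a F H, V F -> V H -> V (fun g => a * F g + H g);
  mean_dom_mulr : forall F h, GG h -> V F -> V (fun g => F (g *g h));
  mean_lin : forall a F H, V F -> V H ->
    I (fun g => a * F g + H g) = a * I F + I H;
  mean_mulr : forall F h, GG h -> V F -> I (fun g => F (g *g h)) = I F;
  mean_le : forall F c, V F -> (forall g, GG g -> F g <= c) -> I F <= c
}.

Variables (V : set ('rV[R]_m -> R)) (I : ('rV[R]_m -> R) -> R).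
Hypothesis VI : invariant_mean V I.

Lemma mean_mono F H : V F -> V H -> (forall g, GG g -> F g <= H g) -> I F <= I H.
Proof.
move=> VF VH FH; have := mean_le VI (c := 0) (mean_dom_lin VI (-1) VH VF).
rewrite (mean_lin VI) // mulN1r addrC subr_le0; apply=> g Gg.
by rewrite mulN1r addrC subr_le0 FH.
Qed.

Lemma mean_eq F H : V F -> V H -> (forall g, GG g -> F g = H g) -> I F = I H.
Proof. by move=> VF VH FH; apply/le_anti/andP; split; apply: mean_mono => // g /FH ->. Qed.

Lemma mean_cst c : I (fun=> c) = c.
Proof.
(* [mean_le] gives upper bounds only; the lower bound comes from the opposite constant. *)
have le d : I (fun=> d) <= d by apply: mean_le VI _ _ (mean_dom_cst VI d) _.
have Ic : I (fun g => (-1) * c + 0) = (-1) * I (fun=> c) + I (fun=> 0).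
  exact: (mean_lin VI (-1) (mean_dom_cst VI c) (mean_dom_cst VI 0)).
have I0 : I (fun g => (-1) * 0 + 0) = (-1) * I (fun=> 0) + I (fun=> 0).
  exact: (mean_lin VI (-1) (mean_dom_cst VI 0) (mean_dom_cst VI 0)).
rewrite mulr0 addr0 in I0.
have := le c; have := le ((-1) * c + 0); rewrite Ic; lra.
Qed.

Lemma mean_sum (J : eqType) (r : seq J) (a : J -> R) (F : J -> 'rV[R]_m -> R) :
  (forall j, j \in r -> V (F j)) ->
  V (fun g => \sum_(j <- r) a j * F j g) /\
  I (fun g => \sum_(j <- r) a j * F j g) = \sum_(j <- r) a j * I (F j).
Proof.
elim: r => [_|j r IHr VF].
  rewrite big_nil (_ : (fun _ => _) = fun=> 0); last first.
    by apply/funext => g; rewrite big_nil.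
  by split; [exact: (mean_dom_cst VI)|exact: mean_cst].
have VFj : V (F j) by apply: VF; rewrite mem_head.
have [|VIr IIr] := IHr; first by move=> i ir; apply: VF; rewrite in_cons ir orbT.
rewrite (_ : (fun _ => _) = fun g => a j * F j g + \sum_(i <- r) a i * F i g).
  split; first exact: (mean_dom_lin VI).
  by rewrite (mean_lin VI) // IIr big_cons.
by apply/funext => g; rewrite big_cons.
Qed.

End MeanTheory.

Section MeanExistence.
Variables (R : realType) (m : nat) (G : real_algebraic_group R m).
Hypothesis cG : compact (grp_set G).
Local Notation GG := (grp_set G).
Local Notation "g '*g' h" := (grp_mul G g h) (at level 40, left associativity).

(** Functions in [V] are linear forms in [e g], and [I] evaluates the same form at the fixed vector
    [v]. Membership of [v] in the hull gives [mean_le], and its fixedness gives invariance. *)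
Lemma exists_invariant_mean (S : finType) (psi : S -> 'rV[R]_m -> R) :
  (forall s, polyfun GG (psi s)) ->
  exists V I, invariant_mean G V I /\ forall s, V (psi s).
Proof.
(* The function 1 is adjoined so that [V] contains the constants. *)
move=> psiP; pose psi' (o : option S) := if o is Some s then psi s else fun=> 1.
have psiP' o : polyfun GG (psi' o) by case: o => [s|]; [exact: psiP|exact: polyfun_cst].
have [N [e [rho [C [eP rhoP e_rho _ psiE]]]]] := exists_stable_span psiP'.
have [v [vK v_rho]] := exists_fixed_mean cG eP rhoP e_rho.
pose rep F := [set b : 'cV[R]_N | forall g, GG g -> F g = (e g *m b) ord0 ord0].
(* The vector representing [F] need not be unique; [IE] shows that the choice does not affect the
   value. The default 0 only concerns functions outside [V]. *)
pose I F := (v *m xget 0 (rep F)) ord0 ord0.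
have IE F b : rep F b -> I F = (v *m b) ord0 ord0.
  move=> Fb; rewrite /I; case: xgetP => [b' _ Fb'|/(_ b) //].
  have le b1 b2 : rep F b1 -> rep F b2 -> (v *m b1) ord0 ord0 <= (v *m b2) ord0 ord0.
    have BE (x : 'rV[R]_N) :
        (x *m (b1 - b2)) ord0 ord0 = (x *m b1) ord0 ord0 - (x *m b2) ord0 ord0.
      by rewrite mulmxBr [LHS]mxE [X in _ + X = _]mxE.
    move=> F1 F2; rewrite -subr_le0 -BE; apply: vK => g Gg.
    by rewrite BE -F1 // -F2 // subrr.
  by apply/le_anti; rewrite !le.
have lin a F H b c : rep F b -> rep H c -> rep (fun g => a * F g + H g) (a *: b + c).
  move=> Fb Hc g Gg.
  by rewrite Fb // Hc // mulmxDr -scalemxAr [RHS]mxE [X in _ = X + _]mxE.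
have mulr F h b : GG h -> rep F b -> rep (fun g => F (g *g h)) (rho h *m b).
  by move=> Gh Fb g Gg; rewrite Fb ?e_rho ?mulmxA //; exact: grp_mulP.
exists [set F | rep F !=set0], I; split; last first.
  by move=> s; exists (C (Some s)) => g Gg; exact: (psiE (Some s)).
split.
- by move=> F H FH [b Fb]; exists b => g Gg; rewrite -FH // Fb.
- move=> c; exists (c *: C None) => g Gg.
  by rewrite -scalemxAr mxE -(psiE None) //= mulr1.
- by move=> a F H [b Fb] [c Hc]; exists (a *: b + c); exact: lin.
- by move=> F h Gh [b Fb]; exists (rho h *m b); exact: mulr.
- move=> a F H [b Fb] [c Hc]; rewrite (IE _ _ (lin a _ _ _ _ Fb Hc)) (IE _ _ Fb) (IE _ _ Hc).
  by rewrite mulmxDr -scalemxAr mxE [X in X + _]mxE.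
- move=> F h Gh [b Fb]; rewrite (IE _ _ (mulr _ _ _ Gh Fb)) (IE _ _ Fb).
  by rewrite mulmxA v_rho.
- by move=> F c [b Fb] Fc; rewrite (IE _ _ Fb); apply: vK => g Gg; rewrite -Fb // Fc.
Qed.

End MeanExistence.

(** * Peak functions *)

Lemma exists_exprn_le (R : realType) (K r s : R) :
  0 <= r < s -> exists k, K * r ^+ k <= s ^+ k.
Proof.
move=> /andP[r0 rs]; have s0 : 0 < s by exact: le_lt_trans rs.
have q1 : `|r / s| < 1.
  by rewrite ger0_norm ?ltr_pdivrMr ?mul1r // divr_ge0 // ltW.
have K0 : 0 < (`|K| + 1)^-1 by rewrite invr_gt0 ltr_wpDl.
have /cvgrPdist_lt/(_ _ K0)[k _ /(_ k (leqnn k))] := cvg_expr q1.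
rewrite /= sub0r normrN => qk; exists k.
have : K * (r / s) ^+ k <= 1.
  apply: le_trans (ler_norm _) _; rewrite normrM.
  have := ltW qk; rewrite -[(`|K| + 1)^-1]mul1r ler_pdivlMr ?ltr_wpDl //.
  have := normr_ge0 K; have := normr_ge0 ((r / s) ^+ k); nra.
by rewrite expr_div_n mulrA ler_pdivrMr ?exprn_gt0 ?mul1r.
Qed.

(** On the compact set [Z] where [w >= eps], [d] attains a positive minimum, which is taken as
    [eta]. *)
Lemma compact_modulus (R : realType) (m : nat) (A : set 'rV[R]_m)
    (d w : 'rV[R]_m -> R) (eps : R) :
  compact A -> polyfun A d -> polyfun A w ->
  (forall x, A x -> 0 <= d x) -> (forall x, A x -> d x = 0 -> w x < eps) ->
  exists2 eta, 0 < eta & forall x, A x -> d x < eta -> w x < eps.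
Proof.
move=> cA dP [q wE] d0 dw.
pose Z := A `&` [set x | - meval (x ord0) q <= - eps].
have cZ : compact Z.
  apply: compact_closedI => //; apply: closed_polyfun_le.
  by exists (- q) => x _; rewrite mevalN.
have ZA : Z `<=` A by move=> x [].
have [Z0|/nonemptyPn Z0] := pselect (Z !=set0); last first.
  exists 1 => // x Ax _; rewrite ltNge; apply/negP => wx.
  have : Z x by split=> //=; rewrite -wE // lerN2.
  by rewrite Z0.
have dZ : polyfun Z d by have [p dE] := dP; exists p => x /ZA; exact: dE.
have [c /set_mem Zc cmin] := EVT_min_rV Z0 cZ (polyfun_continuous dZ).
have [Ac wc] := Zc; exists (d c).
  rewrite lt_neqAle d0 // andbT eq_sym; apply/eqP => dc0.
  by have := dw _ Ac dc0; move: wc; rewrite /= lerN2 wE // leNgt => /negP.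
move=> x Ax dx; rewrite ltNge; apply/negP => wx.
have Zx : Z x by split=> //=; rewrite -wE // lerN2.
by have := cmin x (mem_set Zx); rewrite leNgt dx.
Qed.

Section Peak.
Variables (R : realType) (m : nat) (G : real_algebraic_group R m).
Hypothesis cG : compact (grp_set G).
Local Notation GG := (grp_set G).
Local Notation "g '*g' h" := (grp_mul G g h) (at level 40, left associativity).

(** A point [h] of [G] lies in the set attached to its inverse, since [h *g grp_inv G h] is the
    neutral element; compactness leaves finitely many sets. *)
Lemma finite_translates (d : 'rV[R]_m -> R) (eta : R) :
  polyfun GG d -> d (grp_one G) < eta ->
  exists s : seq 'rV[R]_m, (forall g, g \in s -> GG g) /\
    forall h, GG h -> exists2 g, g \in s & d (h *g g) < eta.
Proof.
move=> dP d1.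
(* Polynomials extend the translates of [d] beyond [G], so that the covering sets are open in the
   ambient space. *)
have /choice[p pE] (g : 'rV[R]_m) : exists p : mpoly m R,
    GG g -> forall h, GG h -> d (h *g g) = meval (h ord0) p.
  have [Gg|nGg] := pselect (GG g); last by exists 0.
  by have [p dE] := polyfun_mulr dP Gg; exists p.
pose U g := [set h : 'rV[R]_m | meval (h ord0) (p g) < eta].
have := cG; rewrite compact_cover => /(_ _ GG U)[g Gg|h Gh|F FG GF].
- apply: (@open_comp _ _ (fun h : 'rV[R]_m => meval (h ord0) (p g)) [set t | t < eta]).
    by move=> h _; exact: meval_continuous.
  exact: open_lt.
- exists (grp_inv G h); first exact: grp_invP.
  by rewrite /U /= -pE ?grp_mulgV //; exact: grp_invP.
exists (enum_fset F); split=> [g gF|h Gh]; first exact/set_mem/FG.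
have [g gF Ugh] := GF _ Gh; exists g => //.
by rewrite pE //; exact/set_mem/FG.
Qed.

(* The mean of [(1 - c d) ^ k] decays more slowly than its values away from the
   neutral element, because finitely many translates of a neighbourhood of the
   neutral element cover [G]; hence the matrix below is close to a multiple of
   the identity. *)
Lemma exists_peak (d : 'rV[R]_m -> R) (N : nat) (tau : 'I_N -> 'I_N -> 'rV[R]_m -> R) :
  polyfun GG d -> (forall g, GG g -> 0 <= d g) ->
  (forall g, GG g -> (d g = 0 <-> g = grp_one G)) ->
  (forall i l, polyfun GG (tau i l)) ->
  (forall i l, tau i l (grp_one G) = (i == l)%:R) ->
  exists c k, forall V I, invariant_mean G V I ->
    let phi g := (1 - c * d g) ^+ k in
    V phi -> (forall i l, V (fun g => phi g * tau i l g)) ->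
    (\matrix_(i, l) I (fun g => phi g * tau i l g)) \in unitmx.
Proof.
move=> dP d_ge0 d_eq0 tauP tau1.
pose n1 : R := N.+1%:R; have n1_gt0 : 0 < n1 by rewrite ltr0n.
(* Half of the tolerance in [unitmx_near_scalar]; the other half is spent on the values of [phi]
   away from the neutral element. *)
pose eps := (2 * n1)^-1.
have eps_gt0 : 0 < eps by rewrite invr_gt0 mulr_gt0.
pose dev i l g := tau i l g - (i == l)%:R.
have devP i l : polyfun GG (dev i l) by apply: polyfunB => //; exact: polyfun_cst.
(* A single polynomial function controlling all the entries, hence the threshold [eps ^+ 2]
   below. *)
pose w g := \sum_i \sum_l dev i l g ^+ 2.
have wP : polyfun GG w by apply: polyfun_sum => i; apply: polyfun_sum => l; exact: polyfunX.
have dev_w i l g : dev i l g ^+ 2 <= w g.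
  rewrite /w (bigD1 i) //= (bigD1 l) //= -addrA lerDl addr_ge0 //.
    by apply: sumr_ge0 => *; exact: sqr_ge0.
  by apply: sumr_ge0 => ? _; apply: sumr_ge0 => *; exact: sqr_ge0.
have [|eta0 eta0_gt0 eta0P] := compact_modulus (eps := eps ^+ 2) cG dP wP d_ge0.
  move=> g Gg /(d_eq0 g Gg) ->; rewrite /w big1 ?exprn_gt0 // => i _.
  by rewrite big1 // => l _; rewrite /dev tau1 subrr expr0n.
have [B B_gt0 dB] := polyfun_bounded cG dP.
have [C C_ge0 devC] : exists2 C, 0 <= C & forall i l g, GG g -> `|dev i l g| <= C.
  have [C C_gt0 wC] := polyfun_bounded cG wP.
  exists (C + 1) => [|i l g Gg]; first by lra.
  have := dev_w i l g; have := wC g Gg; have := ler_norm (w g).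
  rewrite -[_ ^+ 2]real_normK ?num_real //; have := normr_ge0 (dev i l g); nra.
(* With [c = (2 * B)^-1], the minimum ensures [c * eta <= 2^-1], and [1 - c * d g] stays between 1/2
   and 1. *)
pose eta := Num.min eta0 B.
have eta_gt0 : 0 < eta by rewrite lt_min eta0_gt0.
have [eta_eta0 eta_B] : eta <= eta0 /\ eta <= B by rewrite !ge_min !lexx orbT.
have d1 : d (grp_one G) = 0 by apply/d_eq0 => //; exact: grp_oneP.
have [|s [sG sP]] := @finite_translates d (eta / 2) dP; first by rewrite d1; lra.
pose c := (2 * B)^-1.
have cB : c * B = 2^-1 by rewrite /c; field; exact: lt0r_neq0.
have c_gt0 : 0 < c by rewrite invr_gt0 mulr_gt0.
have [ceta_gt0 ceta_le] : 0 < c * eta /\ c * eta <= 2^-1.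
  by rewrite mulr_gt0 // -cB ler_pM2l.
have cd g : GG g -> 0 <= c * d g <= 2^-1.
  move=> Gg; rewrite mulr_ge0 ?(ltW c_gt0) ?d_ge0 //= -cB ler_pM2l //.
  exact: le_trans (ler_norm _) (dB g Gg).
(* Where [d >= eta], [phi] is at most [(1 - c * eta) ^+ k]; where [d < eta / 2], it is at least
   [(1 - c * eta / 2) ^+ k]. The exponent [k] makes the second beat the first despite the number of
   translates and the bound [C]. *)
have [|k kP] := @exists_exprn_le R (2 * n1 * C * (size s)%:R) (1 - c * eta) (1 - c * eta / 2).
  by apply/andP; split; lra.
(* [c] and [k] are fixed before the mean, whose domain must contain functions built from them. *)
exists c, k => V I VI phi Vphi Vtau.
have phi_ge0 g : GG g -> 0 <= phi g.
  by move=> Gg; apply: exprn_ge0; have := cd g Gg; lra.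
(* At each point of [G] one of the translates of [phi] is large, and by invariance all have the same
   mean. *)
have phi_mass : (1 - c * eta / 2) ^+ k <= (size s)%:R * I phi.
  have [|VF IFE] := @mean_sum _ _ _ _ _ VI _ s (fun=> 1) (fun g h => phi (h *g g)).
    by move=> g /sG Gg; exact: (mean_dom_mulr VI).
  have -> : (size s)%:R * I phi = \sum_(g <- s) 1 * I (fun h => phi (h *g g)).
    rewrite (eq_big_seq (fun=> I phi)) => [|g /sG Gg].
      by rewrite big_const_seq count_predT iter_addr_0 mulr_natl.
    by rewrite mul1r (mean_mulr VI).
  rewrite -IFE -[leLHS](mean_cst VI); apply: (mean_mono VI) => //.
    exact: (mean_dom_cst VI).
  move=> h Gh; have [g gs dg] := sP h Gh.
  have Ghg : GG (h *g g) by apply: grp_mulP => //; exact: sG.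
  rewrite (big_rem g) //= mul1r; apply: ler_wpDr.
    rewrite big_seq; apply: sumr_ge0 => j /mem_rem js.
    by rewrite mul1r phi_ge0 //; apply: grp_mulP => //; exact: sG.
  apply: lerXn2r; rewrite ?nnegrE; [by lra|by have := cd _ Ghg; lra|].
  have : c * d (h *g g) <= c * (eta / 2) by rewrite ler_pM2l // ltW.
  lra.
have mass_gt0 : 0 < (1 - c * eta / 2) ^+ k by rewrite exprn_gt0 //; lra.
have s_gt0 : 0 < (size s)%:R :> R.
  rewrite lt_neqAle ler0n andbT eq_sym; apply/eqP => s0.
  by move: phi_mass; rewrite s0 mul0r leNgt mass_gt0.
have tail : 2 * n1 * C * (1 - c * eta) ^+ k <= I phi.
  rewrite -(ler_pM2l s_gt0); apply: le_trans phi_mass; apply: le_trans kP.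
  by rewrite [leLHS]mulrC mulrAC.
have phi_dev i l g : GG g ->
    `|phi g * dev i l g| <= eps * phi g + C * (1 - c * eta) ^+ k.
  move=> Gg; rewrite normrM (ger0_norm (phi_ge0 g Gg)).
  have r_ge0 : 0 <= (1 - c * eta) ^+ k by rewrite exprn_ge0 //; lra.
  have [dg|dg] := ltP (d g) eta.
    have : `|dev i l g| <= eps.
      have := eta0P g Gg (lt_le_trans dg eta_eta0); have := dev_w i l g.
      rewrite -[_ ^+ 2]real_normK ?num_real //; have := normr_ge0 (dev i l g); nra.
    have := phi_ge0 g Gg; nra.
  have : phi g <= (1 - c * eta) ^+ k.
    apply: lerXn2r; rewrite ?nnegrE; [by have := cd g Gg; lra|by lra|].
    by rewrite lerD2l lerN2 ler_pM2l.
  have := devC i l g Gg; have := phi_ge0 g Gg; have := normr_ge0 (dev i l g); nra.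
have mass_pos : 0 < I phi.
  by have := lt_le_trans mass_gt0 phi_mass; rewrite pmulr_rgt0.
apply: (@unitmx_near_scalar _ _ _ (I phi)) => // i l; rewrite mxE.
have Vdev : V (fun g => phi g * dev i l g).
  apply: (mean_dom_ext VI) (mean_dom_lin VI (- (i == l)%:R) Vphi (Vtau i l)) => g _.
  by rewrite /dev; ring.
have -> : I (fun g => phi g * tau i l g) - I phi * (i == l)%:R =
    I (fun g => phi g * dev i l g).
  rewrite -mulNr mulrC addrC mulrN -mulNr -(mean_lin VI) //; apply: (mean_eq VI) => //.
    exact: (mean_dom_lin VI).
  by move=> g _; rewrite /dev; ring.
have le F : V F -> (forall g, GG g -> F g <= eps * phi g + C * (1 - c * eta) ^+ k) ->
    I F <= eps * I phi + C * (1 - c * eta) ^+ k.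
  move=> VF FP; rewrite -[X in _ <= _ + X](mean_cst VI) -(mean_lin VI) //; last first.
    exact: (mean_dom_cst VI).
  apply: (mean_mono VI) => //.
  by apply: (mean_dom_lin VI) => //; exact: (mean_dom_cst VI).
have : `|I (fun g => phi g * dev i l g)| <= eps * I phi + C * (1 - c * eta) ^+ k.
  rewrite ler_norml lerNl; apply/andP; split; last first.
    by apply: le => // g Gg; apply: le_trans (ler_norm _) (phi_dev i l g Gg).
  have VN : V (fun g => (-1) * (phi g * dev i l g) + 0).
    by apply: (mean_dom_lin VI) => //; exact: (mean_dom_cst VI).
  have -> : - I (fun g => phi g * dev i l g) = I (fun g => (-1) * (phi g * dev i l g) + 0).
    by rewrite (mean_lin VI) ?(mean_cst VI) ?mulN1r ?addr0 //; exact: (mean_dom_cst VI).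
  apply: le => // g Gg; rewrite mulN1r addr0.
  by have := phi_dev i l g Gg; rewrite ler_norml lerNl => /andP[].
have epsn : eps * n1 = 2^-1 by rewrite /eps; field; exact: lt0r_neq0.
rewrite -/n1 -(ler_pM2r n1_gt0) => /le_trans; apply.
rewrite mulrDl mulrAC epsn; lra.
Qed.

End Peak.

(** * The orbit map *)

Section Orbit.
Variables (R : realType) (m n : nat) (G : real_algebraic_group R m).
Variables (X : G_real_algebraic_set G n) (x : 'rV[R]_n).
Hypothesis cG : compact (grp_set G).
Hypothesis Xx : gset X x.
Hypothesis trivial_stab : G_stabilizer X x = [set grp_one G].
Local Notation GG := (grp_set G).
Local Notation "g '*g' h" := (grp_mul G g h) (at level 40, left associativity).
Local Notation act := (gset_act X).

Lemma polyfun_act i : polyfun GG (fun g => act g x ord0 i).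
Proof.
have [p actE] := gset_act_poly X.
by apply: polyfun_ext (polyfun_row_mxl GG x (p i)) => g Gg; rewrite actE // poly_mapE.
Qed.

Lemma stab_eq g : GG g -> act g x = x -> g = grp_one G.
Proof.
by move=> Gg gx; have : G_stabilizer X x g; [split|rewrite trivial_stab].
Qed.

Lemma polyfun_factor_orbit t : polyfun GG t ->
  exists p : mpoly n R, forall g, GG g -> t g = meval (act g x ord0) p.
Proof.
move=> tP; have G1 := grp_oneP G.
have [N [f [rho [C [fP rhoP f_rho rho1 tE]]]]] :=
  @exists_stable_span _ _ G unit (fun=> t) (fun=> tP).
(* The inverse appears because [f (h^-1) = f g *m rho ((h g)^-1)]. *)
pose tau i l g := rho (grp_inv G g) i l.
have tauP i l : polyfun GG (tau i l) by exact: polyfun_inv (rhoP i l).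
pose d g := sqnorm (act g x - x).
have dP : polyfun GG d.
  apply: polyfun_sqnorm => i;
  apply: polyfun_ext (polyfunB (polyfun_act i) (polyfun_cst _ (x ord0 i))).
  by move=> g _; rewrite !mxE.
have inv1 : grp_inv G (grp_one G) = grp_one G.
  by rewrite -[LHS](grp_mulg1 (grp_invP G1)) grp_mulVg.
have [|g Gg|i l|c [k peak]] := exists_peak cG dP _ _ tauP.
- by move=> g _; exact: sqnorm_ge0.
- split=> [/sqnorm_eq0/eqP|->]; first by rewrite subr_eq0 => /eqP/stab_eq; apply.
  rewrite /d gset_act1 // subrr /sqnorm big1 // => i _.
  by rewrite mxE expr0n.
- by rewrite /tau inv1 rho1 mxE.
pose phi g := (1 - c * d g) ^+ k.
have phiP : polyfun GG phi.
  by apply/polyfunX/polyfunB; [exact: polyfun_cst|apply: polyfunM => //; exact: polyfun_cst].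
have [pphi pphiE] : polyfun setT (fun y : 'rV[R]_n => (1 - c * sqnorm (y - x)) ^+ k).
  apply/polyfunX/polyfunB; first exact: polyfun_cst.
  apply: polyfunM; first exact: polyfun_cst.
  apply: polyfun_sqnorm => i;
  apply: polyfun_ext (polyfunB (polyfun_coord _ i) (polyfun_cst _ (x ord0 i))).
  by move=> g _; rewrite !mxE.
have [pact actE] := gset_act_poly X.
have [J [q [mu qmuE]]] := meval_split (fun _ : unit => comp_mpoly [tuple pact i | i < n] pphi).
(* Since [h g x = h (g x)], splitting the variables of the action separates [g x] from [h]. *)
have phi_mul g h : GG g -> GG h ->
    phi (h *g g) = \sum_j meval (act g x ord0) (mu tt j) * meval (h ord0) (q j).
  move=> Gg Gh; rewrite /phi /d gset_actM // pphiE // actE //; last exact: gset_actP.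
  under eq_bigr do rewrite mulrC.
  rewrite -qmuE comp_mpoly_meval; apply: meval_eq => i.
  by rewrite tnth_mktuple poly_mapE.
(* The functions whose means are taken: [phi] itself, and the integrands arising on the two sides of
   the averaging identity. *)
pose psi (s : unit + 'I_J * 'I_N + 'I_N * 'I_N) g := match s with
  | inl (inl _) => phi g
  | inl (inr (j, l)) => meval (g ord0) (q j) * f (grp_inv G g) ord0 l
  | inr (i, l) => phi g * tau i l g
  end.
have psiP s : polyfun GG (psi s).
  case: s => [[_|[j l]]|[i l]] //=; apply: polyfunM => //; first exact: polyfun_meval.
  exact: polyfun_inv (fP l).
have [V [I [VI Vpsi]]] := exists_invariant_mean cG psiP.
have Vqf j l := Vpsi (inl (inr (j, l))); have Vtau i l := Vpsi (inr (i, l)).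
rewrite /= in Vqf Vtau.
pose M := \matrix_(i, l) I (fun g => phi g * tau i l g).
have uM : M \in unitmx by apply: (peak V I VI (Vpsi (inl (inl tt)))).
pose coef j l := I (fun g => meval (g ord0) (q j) * f (grp_inv G g) ord0 l).
have fM g l : GG g -> (f g *m M) ord0 l = \sum_j meval (act g x ord0) (mu tt j) * coef j l.
  move=> Gg.
  have [VF IFE] := mean_sum VI (r := index_enum _) (fun i => f g ord0 i) (fun i _ => Vtau i l).
  have [VH IH] := mean_sum VI (r := index_enum _)
    (fun j => meval (act g x ord0) (mu tt j)) (fun j _ => Vqf j l).
  rewrite mxE -IH; under eq_bigr do rewrite mxE.
  (* Right translation by [g] turns the integrand of [f g *m M] into [phi (h g) f (h^-1)], which
     [phi_mul] expands. *)
  rewrite -IFE -(mean_mulr VI Gg) //; apply: (mean_eq VI) => //.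
    exact: (mean_dom_mulr VI Gg VF).
  move=> h Gh; under [RHS]eq_bigr do rewrite mulrA.
  rewrite -mulr_suml -phi_mul //.
  have Ghg := grp_mulP Gh Gg; have Ghgi := grp_invP Ghg.
  have -> : grp_inv G h = g *g grp_inv G (h *g g).
    have Ghi := grp_invP Gh.
    rewrite -[RHS](grp_mul1g (grp_mulP Gg Ghgi)) -(grp_mulVg Gh).
    rewrite -grp_mulA //; last exact: grp_mulP.
    by rewrite (grp_mulA Gh) // grp_mulgV // grp_mulg1.
  rewrite f_rho // mxE mulr_sumr; apply: eq_bigr => i _.
  by rewrite mulrCA.
have [p pE] : polyfun setT (fun y : 'rV[R]_n =>
    ((\row_l \sum_j meval (y ord0) (mu tt j) * coef j l) *m (invmx M *m C tt)) ord0 ord0).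
  apply: polyfun_mulmx => l.
  apply: (@polyfun_ext _ _ _ (fun y => \sum_j meval (y ord0) (mu tt j) * coef j l)).
    by move=> y _; rewrite mxE.
  by apply: polyfun_sum => j; apply: polyfunM (polyfun_cst _ _); exact: polyfun_meval.
exists p => g Gg; rewrite -pE // (tE tt) //.
rewrite (_ : \row_l _ = f g *m M); last by apply/rowP => l; rewrite fM // mxE.
by rewrite mulmxA mulmxK.
Qed.

Lemma act_inj g h : GG g -> GG h -> act g x = act h x -> g = h.
Proof.
move=> Gg Gh gh; have Ghi := grp_invP Gh.
have /stab_eq : act (grp_inv G h *g g) x = x.
  by rewrite gset_actM // gh -gset_actM // grp_mulVg // gset_act1.
move=> /(_ (grp_mulP Ghi Gg)) E.
by rewrite -(grp_mul1g Gg) -(grp_mulgV Gh) -grp_mulA // E grp_mulg1.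
Qed.

Lemma exists_poly_inverse :
  exists q : 'I_m -> mpoly n R, forall g, GG g -> poly_map q (act g x) = g.
Proof.
have /choice[q qE] i := polyfun_factor_orbit (polyfun_coord GG i).
by exists q => g Gg; apply/rowP => i; rewrite poly_mapE -qE.
Qed.

End Orbit.

(** The image consists of the [y] for which [q y] lies in [A] and [f (q y) = y]. Both conditions are
    polynomial in [y]: the equations of [A] are pulled back by [q], and the second condition is read
    coordinatewise. *)
Lemma real_algebraic_orbit (R : realType) (m n : nat) (A : set 'rV[R]_m)
    (f : 'rV[R]_m -> 'rV[R]_n) (q : 'I_m -> mpoly n R) :
  real_algebraic A -> polynomial_on A f -> (forall x, A x -> poly_map q (f x) = x) ->
  real_algebraic (f @` A).
Proof.
move=> [F AE] [p fE] qf.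
pose cq (r : mpoly m R) := comp_mpoly [tuple q i | i < m] r.
have cqE r (y : 'rV[R]_n) : meval (y ord0) (cq r) = meval (poly_map q y ord0) r.
  rewrite comp_mpoly_meval; apply: meval_eq => i.
  by rewrite tnth_mktuple poly_mapE.
exists ((cq @` F) `|` range (fun i => cq (p i) - mpolyX R (mnm1 i))).
apply/seteqP; split=> [y [x Ax <-] r [[s Fs <-]|[i _ <-]]|y yP].
- by rewrite cqE qf //; move: Ax; rewrite AE; exact.
- by rewrite mevalB mevalXU cqE qf // fE // poly_mapE subrr.
have Aqy : A (poly_map q y).
  by rewrite AE => r Fr; rewrite -cqE; apply: yP; left; exists r.
exists (poly_map q y) => //; apply/rowP => i; rewrite fE // poly_mapE -cqE.
apply/eqP; rewrite -subr_eq0 -(mevalXU (y ord0)) -mevalB; apply/eqP/yP.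
by right; exists i.
Qed.

Theorem proposition7p1p1 (R : realType) (m n : nat)
    (G : real_algebraic_group R m) (G_compact : compact (grp_set G))
    (X : G_real_algebraic_set G n) (x : 'rV[R]_n) (Xx : gset X x)
    (trivial_stab : G_stabilizer X x = [set grp_one G]) :
  polynomial_isomorphism (grp_set G) (G_orbit X x) (fun g => gset_act X g x).
Proof.
have [q qE] := exists_poly_inverse G_compact Xx trivial_stab.
have actP : polynomial_on (grp_set G) (fun g => gset_act X g x).
  have /choice[p pE] := polyfun_act Xx.
  by exists p => g Gg; apply/rowP => i; rewrite pE // poly_mapE.
split=> //.
- exact: grp_algebraic.
- exact: real_algebraic_orbit (grp_algebraic G) actP qE.
- split; first by move=> g Gg; exists g.
    by move=> g h /set_mem Gg /set_mem Gh; exact: act_inj.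
  by move=> y [g Gg <-]; exists g.
- by exists (poly_map q) => //; exists q.
Qed.
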